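(* Let $G=(V,E)$ be a graph, $p\colon V\to\mathbb{Z}_{>0}$, $\prec$ a total order on $V$, and $u\in V$. If $\sum_{v\in\bar N^+(u)}\lambda_v z_v\le\lambda_0$ is facet-defining for $\textsc{stab}(G^+(u))$, then $\sum_{v\in\bar N^+(u)}\lambda_v x_{uv}\le\lambda_0\gamma_u$ is facet-defining for $\mathcal P(G,p)$, where $\gamma_u=1$ if $u\in S$ and $\gamma_u=x_{uu}$ otherwise.
   Context: $n=|V|$, $\bar E$ is the edge set of the complement of $G$ and $\bar e=|\bar E|$. Let $\bar N^-(v)=\{u\in V: u\prec v,\ \{u,v\}\notin E\}$, $\bar N^+(v)=\{u\in V: v\prec u,\ \{u,v\}\notin E\}$, $\bar N^-[v]=\bar N^-(v)\cup\{v\}$, $S=\{v:\bar N^-(v)=\emptyset\}$, $T=\{v:\bar N^+(v)=\emptyset\}$. $G^+(u)$ is the subgraph of $G$ induced by $\bar N^+(u)$. For a graph $H$, $\textsc{stab}(H)=\operatorname{conv}\{z\in\{0,1\}^{|V(H)|}: z_a+z_b\le1\ \forall\{a,b\}\in E(H)\}$. Variables: $x_{ab}$ for $b\in V$, $a\in\bar N^-(b)$, and $x_{bb}$ for $b\in V\setminus S$ (so $n+\bar e-|S|$ variables), plus a real variable $y$. $\mathcal K(v)$ is the collection of subsets of $\bar N^+(v)$ inducing a clique of size 2 in $G$ or a maximal clique of size 1 in $G[\bar N^+(v)]$. Constraints: (C1) $\sum_{a\in\bar N^-[v]}x_{av}\ge1$ for $v\in V\setminus S$; (C2) $\sum_{a\in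 K}x_{va}\le x_{vv}$ for $v\in(V\setminus T)\setminus S$, $K\in\mathcal K(v)$; (C3) $\sum_{a\in K}x_{va}\le 1$ for $v\in(V\setminus T)\cap S$, $K\in\mathcal K(v)$; (C4) $p(v)x_{vv}+\sum_{a\in\bar N^+(v)}p(a)x_{va}\le y$ for $v\in V\setminus S$; (C5) $p(v)+\sum_{a\in\bar N^+(v)}p(a)x_{va}\le y$ for $v\in S$. $\mathcal P(G,p)=\operatorname{conv}\{(y,x)\in\mathbb{R}_{\ge0}\times\{0,1\}^{n+\bar e-|S|}:(y,x)\text{ satisfies (C1)–(C5)}\}$.
   Formalization: The formal theorem also assumes λ_v ≥ 0 for each v in N̄⁺(u) with N̄⁻(v)={u}; otherwise the claim is false: for V={u,v}, no edges, u≺v, the facet −z_v ≤ 0 lifts to −x_uv ≤ 0, whose face has x_vv=1 forced and is not a facet. *)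

(* Defs.v *)
From HB Require Import structures.
From mathcomp Require Import all_boot all_order all_algebra.
From mathcomp Require Import boolp classical_sets reals.

Set Implicit Arguments.
Unset Strict Implicit.
Unset Printing Implicit Defensive.

Import Order.TTheory GRing.Theory Num.Theory.
Local Open Scope ring_scope.

Section Polyhedra.
Variables (R : realType) (E : lmodType R).

Definition conv (A : set E) : set E := fun x =>
  exists (k : nat) (t : 'I_k -> R) (a : 'I_k -> E),
    [/\ forall i, 0 <= t i,
        \sum_i t i = 1,
        forall i, A (a i)
      & x = \sum_i t i *: a i].

Definition affinely_independent (k : nat) (q : 'I_k -> E) : Prop :=
  forall c : 'I_k -> R,
    \sum_i c i = 0 -> \sum_i c i *: q i = 0 -> forall i, c i = 0.

(* [X] contains [d + 1], but not [d + 2], affinely independent points.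
   As [d] is a natural number, the empty set (of dimension -1) has no
   dimension in this sense. *)
Definition has_dim (X : set E) (d : nat) : Prop :=
  (exists q : 'I_d.+1 -> E, (forall i, X (q i)) /\ affinely_independent q)
  /\ (forall q : 'I_d.+2 -> E, (forall i, X (q i)) -> ~ affinely_independent q).

(* The inequality [l z <= r z] is facet-defining for [P]: it is valid for [P],
   and the face where it is tight is a facet, that is, a nonempty face of
   dimension [dim P - 1]. *)
Definition facet_defining (P : set E) (l r : E -> R) : Prop :=
  (forall z, P z -> l z <= r z)
  /\ exists d : nat,
       has_dim P d.+1 /\ has_dim (fun z => P z /\ l z = r z) d.

End Polyhedra.

Definition is_binary (R : realType) (I : finType) (z : {ffun I -> R^o}) : Prop :=
  forall i, z i = 0 \/ z i = 1.

Definition stab (R : realType) (W : finType) (h : rel W) :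
    set {ffun W -> R^o} :=
  conv (fun z : {ffun W -> R^o} =>
    is_binary z /\ forall a b, h a b -> z a + z b <= 1).

Definition strict_total_order (V : finType) (prec : rel V) : Prop :=
  [/\ irreflexive prec, transitive prec
    & forall a b, a != b -> prec a b || prec b a].

Section Representatives.
Variables (R : realType) (V : finType) (e prec : rel V) (p : V -> nat).

Definition Nminus (v : V) : {set V} := [set u : V | prec u v && ~~ e u v]%SET.
Definition Nplus (v : V) : {set V} := [set u : V | prec v u && ~~ e u v]%SET.
Definition Nminusc (v : V) : {set V} := (v |: Nminus v)%SET.
Definition Sset : {set V} := [set v : V | Nminus v == finset.set0]%SET.
Definition Tset : {set V} := [set v : V | Nplus v == finset.set0]%SET.

(* Vertex set and edge relation of the subgraph of G induced by [Nplus u] *)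
Definition Gplus_vertex (u : V) : finType := {v : V | v \in Nplus u}.
Definition Gplus (u : V) : rel (Gplus_vertex u) :=
  [rel a b : Gplus_vertex u | e (val a) (val b)].

Definition clique (K : {set V}) : bool :=
  [forall a in K, forall b in K, (a != b) ==> e a b].

Definition Kcoll (v : V) (K : {set V}) : bool :=
  (K \subset Nplus v)
  && (clique K && (#|K| == 2)
      || (#|K| == 1)
         && maxset [pred A : {set V} | (A \subset Nplus v) && clique A] K).

Definition is_var (ab : V * V) : bool :=
  (ab.1 \in Nminus ab.2) || (ab.1 == ab.2) && (ab.2 \notin Sset).

Definition var : finType := {ab : V * V | is_var ab}.

(* The coordinate [x_ab]; the default value 0 is used only if [(a, b)] is not
   an index of a variable, which never happens below. *)
Definition xcoord (x : {ffun var -> R^o}) (a b : V) : R :=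
  if insub (a, b) is Some k then x k else 0.

Definition constraints (y : R) (x : {ffun var -> R^o}) : Prop :=
  [/\ forall v, v \notin Sset -> 1 <= \sum_(a in Nminusc v) xcoord x a v,
      forall v K, v \notin Tset -> v \notin Sset -> Kcoll v K ->
        \sum_(a in K) xcoord x v a <= xcoord x v v,
      forall v K, v \notin Tset -> v \in Sset -> Kcoll v K ->
        \sum_(a in K) xcoord x v a <= 1,
      forall v, v \notin Sset ->
        (p v)%:R * xcoord x v v
          + \sum_(a in Nplus v) (p a)%:R * xcoord x v a <= y
    & forall v, v \in Sset ->
        (p v)%:R + \sum_(a in Nplus v) (p a)%:R * xcoord x v a <= y].

Definition Ppoly : set (R^o * {ffun var -> R^o}) :=
  conv (fun yx : R^o * {ffun var -> R^o} =>
    [/\ 0 <= (yx.1 : R), is_binary yx.2 & constraints yx.1 yx.2]).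

Definition gamma (x : {ffun var -> R^o}) (u : V) : R :=
  if u \in Sset then 1 else xcoord x u u.

End Representatives.

Arguments Ppoly R {V} e prec p.
Arguments stab R {W} h.

(* Main.v *)
(* A point z of STAB(G+(u)) lifts to P(G,p): let row u of x be z, let every
   vertex represent itself, and take y large. A facet of STAB(G+(u)) thus gives
   |N+(u)| affinely independent points of the lifted face, and one perturbation
   per remaining coordinate completes them to a facet: increase y; switch on an
   entry x_ab with a <> u; switch off a diagonal entry x_vv by letting some other
   vertex represent v. The delicate case is N-(v) = {u}, where only u can
   represent v, so that a vertex of the original facet with z_v = 1 is needed;
   it exists because lambda_v >= 0. For v = u, row u is set to 0 as well, which
   makes both sides of the lifted inequality vanish. *)
Require Import Defs.
From HB Require Import structures.
From mathcomp Require Import all_boot all_order all_algebra.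
From mathcomp Require Import boolp classical_sets reals.

Set Implicit Arguments.
Unset Strict Implicit.
Unset Printing Implicit Defensive.

Import Order.TTheory GRing.Theory Num.Theory.
Local Open Scope ring_scope.

(** * Affine independence and dimension *)

Section AffineIndependence.
Import VectorInternalTheory.
Variables (R : realType).

Lemma sum_option (U : nmodType) (T : finType) (F : option T -> U) :
  \sum_o F o = F None + \sum_t F (Some t).
Proof.
rewrite (bigD1 None) //=; congr (_ + _).
rewrite (reindex_omap some id) => [|[t|] //].
by apply: eq_bigl => t; rewrite /= eqxx.
Qed.

(** The index is any finite type, so that families can be indexed by vertices or variables and gain
    a point through [option]. *)
Definition aff_indep (E : lmodType R) (T : finType) (q : T -> E) : Prop :=
  forall c : T -> R, \sum_t c t = 0 -> \sum_t c t *: q t = 0 ->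
    forall t, c t = 0.

Lemma aff_indep_comp (E : lmodType R) (S T : finType) (f : S -> T)
    (q : T -> E) :
  injective f -> aff_indep q -> aff_indep (q \o f).
Proof.
move=> f_inj qI c c0 cq0 s.
have imc t : \sum_(s | f s == f t) c s = c t.
  by rewrite (big_pred1 t) // => s'; rewrite /= inj_eq.
rewrite -imc; apply: (qI (fun t => \sum_(s | f s == t) c s)).
  by rewrite -[RHS]c0 [RHS](partition_big f xpredT).
rewrite -[RHS]cq0 [RHS](partition_big f xpredT) //; apply: eq_bigr => t _.
by rewrite scaler_suml; apply: eq_bigr => s' /eqP <-.
Qed.

(** Homogenization: with a leading 1 added to each point, affine independence becomes linear
    independence of the rows of a matrix with [1 + dim E] columns. *)
Lemma aff_indep_card (E : vectType R) (T : finType) (q : T -> E) :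
  aff_indep q -> (#|T| <= (dim E).+1)%N.
Proof.
move=> qI; pose A := \matrix_(i < #|T|) row_mx (1%:M : 'M_1) (v2r (q (enum_val i))).
suff /eqP <- : row_free A by exact: rank_leq_col.
apply: inj_row_free => v vA0.
have: \sum_i v 0 i *: row i A = 0 by rewrite -mulmx_sum_row.
under eq_bigr do rewrite rowK scale_row_mx.
move=> vE.
have c0 : \sum_i v 0 i = 0.
  have := congr1 (fun M : 'rV_(1 + dim E) => lsubmx M 0 0) vE.
  rewrite /= !linear_sum linear0 summxE mxE => sum0; rewrite -[RHS]sum0.
  by apply: eq_bigr => i _; rewrite /= row_mxKl !mxE mulr1.
have cq0 : \sum_i v 0 i *: q (enum_val i) = 0.
  have := congr1 (fun M : 'rV_(1 + dim E) => r2v (rsubmx M)) vE.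
  rewrite /= !linear_sum !linear0 => sum0; rewrite -[RHS]sum0.
  by apply: eq_bigr => i _; rewrite /= row_mxKr linearZ /= v2rK.
apply/rowP=> i; rewrite mxE.
exact: (aff_indep_comp (@enum_val_inj T predT) qI) c0 cq0 i.
Qed.

(** Applying [f] to a vanishing affine combination leaves [c None * (f x - r) = 0], so the new point
    has coefficient 0. *)
Lemma aff_indep_extend (E : lmodType R) (T : finType) (q : T -> E) (x : E)
    (f : {linear E -> R^o}) (r : R) :
  aff_indep q -> (forall t, f (q t) = r) -> f x <> r ->
  aff_indep (fun o : option T => oapp q x o).
Proof.
move=> qI fq fx c; rewrite !sum_option /= => c0 cq0.
have fcq := congr1 f cq0.
have cN : c None = 0.
  move: fcq; rewrite linearD linear0 linear_sum linearZ /=.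
  under eq_bigr do rewrite linearZ /= fq.
  rewrite -scaler_suml; move/eqP: c0; rewrite addrC addr_eq0 => /eqP ->.
  rewrite scaleNr -scalerBr => /eqP; rewrite scaler_eq0 subr_eq0.
  by case/orP => /eqP // /fx.
move: c0 cq0; rewrite cN scale0r !add0r => c0 cq0 [t|//].
exact: (qI (c \o some)).
Qed.

Lemma has_dim_intro (E : lmodType R) (X : set E) (d : nat) (T : finType)
    (q : T -> E) :
  #|T| = d.+1 -> aff_indep q -> (forall t, X (q t)) ->
  (forall q : 'I_d.+2 -> E, (forall i, X (q i)) -> ~ affinely_independent q) ->
  has_dim X d.
Proof.
move=> cT qI Xq maxX; split=> //.
exists (fun i => q (enum_val (cast_ord (esym cT) i))); split=> // c.
apply: (@aff_indep_comp _ _ _ (fun i => enum_val (cast_ord (esym cT) i))) => //.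
by move=> i j /enum_val_inj/cast_ord_inj.
Qed.

Lemma has_dim_family (E : lmodType R) (X : set E) (d : nat) (T : finType) :
  has_dim X d -> #|T| = d.+1 ->
  exists q : T -> E, (forall t, X (q t)) /\ aff_indep q.
Proof.
move=> [[q [Xq qI]] _] cT; exists (fun t => q (cast_ord cT (enum_rank t))).
split=> //; apply: (@aff_indep_comp _ _ _ (fun t => cast_ord cT (enum_rank t))) => //.
by move=> s t /cast_ord_inj/enum_rank_inj.
Qed.

(** If [d < d'], the first [d.+2] points witnessing [d'] contradict the maximality of [d]. *)
Lemma has_dim_uniq (E : lmodType R) (X : set E) (d d' : nat) :
  has_dim X d -> has_dim X d' -> d = d'.
Proof.
wlog lt_dd : d d' / (d < d')%N => [hw hd hd'|].
  by have [/hw|/hw/(_ hd' hd)|//] := ltngtP d d'; last move->; exact.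
move=> [_ maxX] [[q [Xq qI]] _]; exfalso.
apply: (maxX (q \o widen_ord (lt_dd : (d.+2 <= d'.+1)%N))) => [i|]; first exact: Xq.
by apply: aff_indep_comp => // i j /(congr1 val) /= /val_inj.
Qed.

End AffineIndependence.

(** * Maps and faces of convex hulls *)

Section ConvexHull.
Variables (R : realType).

Lemma conv_incl (E : lmodType R) (A : set E) (x : E) : A x -> conv A x.
Proof.
by move=> Ax; exists 1%N, (fun=> 1), (fun=> x); split=> //;
  rewrite big_ord1 ?scale1r.
Qed.

(** Only affine combinations need be preserved: the map [lift] used later is affine but not
    linear. *)
Lemma conv_image (E F : lmodType R) (A : set E) (B : set F) (f : E -> F) :
  (forall k (t : 'I_k -> R) (a : 'I_k -> E), \sum_i t i = 1 ->
    f (\sum_i t i *: a i) = \sum_i t i *: f (a i)) ->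
  (forall a, A a -> B (f a)) -> forall z, conv A z -> conv B (f z).
Proof.
move=> fA AB z [k [t [a [t0 t1 Aa ->]]]].
by exists k, t, (f \o a); split=> // [i|]; [exact: AB | exact: fA].
Qed.

Lemma conv_le (E : lmodType R) (A : set E) (f : {linear E -> R^o}) (r : R) :
  (forall a, A a -> f a <= r) -> forall z, conv A z -> f z <= r.
Proof.
move=> Af z [k [t [a [t0 t1 Aa ->]]]]; rewrite linear_sum.
rewrite -[leRHS]mul1r -t1 mulr_suml; apply: ler_sum => i _.
by rewrite linearZ; apply: ler_wpM2l => //; apply: Af.
Qed.

(** If [f z = r], the nonnegative terms [t i * (r - f (a i))] sum to 0, so only generators on the
    face carry weight. *)
Lemma conv_face (E : lmodType R) (A : set E) (f g : {linear E -> R^o}) (r : R) :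
  (forall a, A a -> f a <= r) -> (forall a, A a -> f a = r -> g a = 0) ->
  forall z, conv A z -> f z = r -> g z = 0.
Proof.
move=> Af Ag z [k [t [a [t0 t1 Aa ->]]]] fz.
have: \sum_i t i * (r - f (a i)) = 0.
  under eq_bigr do rewrite mulrBr.
  rewrite sumrB -mulr_suml t1 mul1r -fz linear_sum.
  by under [X in _ - X]eq_bigr do rewrite -[_ * _]linearZ; rewrite subrr.
move/psumr_eq0P => tf0; rewrite linear_sum big1 // => i _; rewrite linearZ /=.
have /eqP: t i * (r - f (a i)) = 0.
  by apply: tf0 => // j _; rewrite mulr_ge0 // subr_ge0; apply: Af.
rewrite mulf_eq0 subr_eq0 => /orP[/eqP->|/eqP fr]; first by rewrite scale0r.
by rewrite Ag // scaler0.
Qed.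

End ConvexHull.

(** * The stable set polytope *)

Section StableSetPolytope.
Variables (R : realType) (W : finType) (h : rel W).

Definition stable_vector (z : {ffun W -> R^o}) : Prop :=
  is_binary z /\ forall a b, h a b -> z a + z b <= 1.

Definition eval_at (w : W) (z : {ffun W -> R^o}) : R^o := z w.
Definition dotf (lam : W -> R) (z : {ffun W -> R^o}) : R^o :=
  \sum_w lam w * z w.
Definition unitf (w : W) : {ffun W -> R^o} := [ffun a => (a == w)%:R].

Fact eval_at_linear (w : W) : linear (eval_at w).
Proof. by move=> a x y; rewrite /eval_at !ffunE. Qed.
HB.instance Definition _ w :=
  GRing.isLinear.Build R {ffun W -> R^o} R^o _ (eval_at w) (eval_at_linear w).

Fact dotf_linear (lam : W -> R) : linear (dotf lam).
Proof.
move=> a x y; rewrite /dotf scaler_sumr -big_split; apply: eq_bigr => w _.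
by rewrite !ffunE mulrDr mulrCA.
Qed.
HB.instance Definition _ lam :=
  GRing.isLinear.Build R {ffun W -> R^o} R^o _ (dotf lam) (dotf_linear lam).

Lemma dotf_unitf (lam : W -> R) (w : W) : dotf lam (unitf w) = lam w.
Proof.
rewrite /dotf (bigD1 w) //= ffunE eqxx mulr1 big1 ?addr0 // => a /negPf aw.
by rewrite ffunE aw mulr0.
Qed.

Lemma stable_vector0 : stable_vector 0.
Proof.
by split=> [w|a b _]; rewrite !ffunE; [left | rewrite addr0 ler01].
Qed.

Lemma stable_vector_unitf (h_irr : irreflexive h) (w : W) :
  stable_vector (unitf w).
Proof.
split=> [a|a b hab]; rewrite !ffunE; first by case: eqP; [right|left].
have: ~~ ((a == w) && (b == w)).
  by apply/negP => /andP[/eqP aw /eqP bw]; move: hab; rewrite aw bw h_irr.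
by do 2![case: eqP => _] => //= _; rewrite ?addr0 ?add0r ?ler01.
Qed.

Lemma aff_indep_unitf : aff_indep (fun o : option W => oapp unitf 0 o).
Proof.
move=> c; rewrite !sum_option /= scaler0 add0r => c0 cq0.
have cS w : c (Some w) = 0.
  have := congr1 (eval_at w) cq0.
  rewrite linear_sum linear0 (bigD1 w) //= /eval_at !ffunE eqxx.
  rewrite -[_ *: _]/(_ * _) mulr1 big1 ?addr0 // => a /negPf aw.
  by rewrite !ffunE eq_sym aw scaler0.
case=> // ; rewrite big1 ?addr0 in c0 => // w _; exact: cS.
Qed.

Lemma has_dim_stab (h_irr : irreflexive h) : has_dim (stab R h) #|W|.
Proof.
apply: (has_dim_intro (card_option W) aff_indep_unitf) => [[w|]|q _ qI] /=.
- exact/conv_incl/stable_vector_unitf.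
- exact/conv_incl/stable_vector0.
- have := aff_indep_card (qI : aff_indep q).
  by rewrite card_ord [dim _]muln1 ltnn.
Qed.

(** * Points on a facet of the stable set polytope *)

Section Facet.
Hypothesis h_irr : irreflexive h.
Variables (lam : W -> R) (lam0 : R).
Hypothesis facet_lam : facet_defining (stab R h) (dotf lam) (fun=> lam0).

Lemma stab_facet_valid z : stable_vector z -> dotf lam z <= lam0.
Proof. by case: facet_lam => + _ sz; apply; apply: conv_incl. Qed.

(** Otherwise the face would be the whole polytope and have its dimension. *)
Lemma stab_facet_proper : exists2 z, stab R h z & dotf lam z <> lam0.
Proof.
case: facet_lam => _ [d [dimS dimF]]; apply: contrapT => noz.
suff FE : (fun z => stab R h z /\ dotf lam z = lam0) = stab R h.
  by rewrite FE in dimF; have /esym/n_Sn := has_dim_uniq dimS dimF.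
apply/funext => z; apply/propext; split=> [[]//|Sz]; split=> //.
by apply: contrapT => ne; apply: noz; exists z.
Qed.

(** The polytope has dimension [#|W|], which a facet forces to be a successor. *)
Lemma stab_facet_card : (0 < #|W|)%N.
Proof.
by case: facet_lam => _ [d [/has_dim_uniq/(_ (has_dim_stab h_irr)) <-]].
Qed.

Lemma stab_facet_family :
  exists q : W -> {ffun W -> R^o},
    (forall w, stab R h (q w) /\ dotf lam (q w) = lam0) /\ aff_indep q.
Proof.
case: facet_lam => _ [d [dimS dimF]].
by apply: has_dim_family dimF _; rewrite (has_dim_uniq dimS (has_dim_stab h_irr)).
Qed.

(* If all stable vectors on the facet avoid w, then the facet is contained in
   the facet z_w = 0 of the stable set polytope, so that lam is supported on w
   and lam0 = 0; validity at the unit vector of w then forces lam = 0. *)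
Lemma stab_facet_touches (w : W) :
  0 <= lam w ->
  exists z, [/\ stable_vector z, dotf lam z = lam0 & z w = 1].
Proof.
move=> lam_w; apply: contrapT => noz.
have face0 z : stab R h z -> dotf lam z = lam0 -> eval_at w z = 0.
  apply: (conv_face stab_facet_valid) => a sa la.
  case: (sa) => /(_ w) [//|aw1] _; case: noz; by exists a.
have [q [Fq qI]] := stab_facet_family.
(* A counterexample [x], followed by [unitf w], would extend the family [q] to [#|W| + 2] affinely
   independent points in dimension [#|W|]. *)
have face_plane x : eval_at w x = 0 -> dotf lam x = lam0.
  move=> xw; apply: contrapT => nx.
  have qxI := aff_indep_extend qI (fun w' => proj2 (Fq w')) nx.
  suff /aff_indep_card : aff_indep (fun o => oapp (fun o' => oapp q x o') (unitf w) o).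
    by rewrite !card_option [dim _]muln1 ltnn.
  apply: (aff_indep_extend (f := eval_at w) (r := 0) qxI) => [[w'|]|] //=.
    by have [Sq lq] := Fq w'; apply: face0.
  by rewrite /eval_at ffunE eqxx; apply/eqP; rewrite oner_eq0.
have lam00 : lam0 = 0 by rewrite -(face_plane 0) ?linear0.
have lam_supp a : a != w -> lam a = 0.
  move=> aw; rewrite -dotf_unitf face_plane // /eval_at ffunE.
  by rewrite eq_sym (negPf aw).
have lamw0 : lam w = 0.
  apply/eqP; rewrite eq_le lam_w andbT -dotf_unitf -lam00.
  exact/stab_facet_valid/stable_vector_unitf.
have [z _ []] := stab_facet_proper.
rewrite lam00 /dotf big1 // => a _.
by have [->|/lam_supp ->] := eqVneq a w; rewrite ?lamw0 mul0r.
Qed.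

End Facet.
End StableSetPolytope.

(** * Lifting stable vectors to feasible points *)

Section Lifting.
Variables (R : realType) (V : finType) (e prec : rel V) (p : V -> nat).
Hypotheses (e_sym : symmetric e) (e_irr : irreflexive e).
Hypothesis prec_irr : irreflexive prec.

Local Notation Nplus := (Nplus e prec).
Local Notation Sset := (Sset e prec).
Local Notation var := (var e prec).

Lemma NplusE (a b : V) : (b \in Nplus a) = (a \in Nminus e prec b).
Proof. by rewrite !inE e_sym. Qed.

Lemma Nplus_neq (a b : V) : b \in Nplus a -> a != b.
Proof. by rewrite inE => /andP[ab _]; apply: contraTneq ab => ->; rewrite prec_irr. Qed.

Lemma is_var_Nplus (a b : V) : b \in Nplus a -> is_var e prec (a, b).
Proof. by rewrite NplusE /is_var /= => ->. Qed.

Lemma is_var_diag (v : V) : v \notin Sset -> is_var e prec (v, v).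
Proof. by rewrite /is_var /= eqxx => ->; rewrite orbT. Qed.

Lemma xcoord_binary (x : {ffun var -> R^o}) (a b : V) :
  is_binary x -> xcoord x a b = 0 \/ xcoord x a b = 1.
Proof. by move=> xb; rewrite /xcoord; case: insubP => [k _ _|_]; [apply: xb|left]. Qed.

Fact xcoord_linear (a b : V) :
  linear (fun x : {ffun var -> R^o} => xcoord x a b : R^o).
Proof.
move=> c x y; rewrite /xcoord; case: insubP => [k _ _|_]; rewrite ?ffunE //.
by rewrite scaler0 addr0.
Qed.

Definition feasible_point (yx : R^o * {ffun var -> R^o}) : Prop :=
  [/\ 0 <= (yx.1 : R), is_binary yx.2 & constraints p yx.1 yx.2].

Lemma Kcoll_pair (v a b : V) :
  a \in Nplus v -> b \in Nplus v -> e a b -> Kcoll e prec v [set a; b]%SET.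
Proof.
move=> av bv ab; have ne : a != b by apply: contraTneq ab => ->; rewrite e_irr.
apply/andP; split; first by apply/fintype.subsetP => c; rewrite !inE => /orP[]/eqP ->;
  [move: av | move: bv]; rewrite inE.
rewrite cards2 ne andbT; apply/orP; left.
apply/forall_inP => c; rewrite !inE => cab; apply/forall_inP => d.
rewrite !inE => dab; apply/implyP; move: cab dab.
by do 2!case/orP => /eqP ->; rewrite ?eqxx ?ab // e_sym ab.
Qed.

Lemma Kcoll_single (v a : V) :
  a \in Nplus v -> (forall b, b \in Nplus v -> ~~ e a b) ->
  Kcoll e prec v [set a]%SET.
Proof.
move=> av noe; apply/andP; split; first by rewrite finset.sub1set.
rewrite cards1 /= andbF /=; apply/maxsetP; split.
  rewrite /= finset.sub1set av; apply/forall_inP => c /finset.set1P ->.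
  by apply/forall_inP => d /finset.set1P ->; rewrite eqxx.
move=> B /= /andP[BN clB]; rewrite finset.sub1set => aB.
apply/finset.setP => b; rewrite inE; apply/idP/eqP => [bB|->//].
apply: contraTeq (noe b (fintype.subsetP BN b bB)) => ba; rewrite negbK.
by move/forall_inP/(_ a aB)/forall_inP/(_ b bB): clB; rewrite eq_sym ba.
Qed.

Lemma Nplus_notin_T (v a : V) : a \in Nplus v -> v \notin Tset e prec.
Proof. by move=> av; rewrite inE; apply/finset.set0Pn; exists a. Qed.

(** Each [a] lies in a member of the clique collection: an edge if it has a neighbour in [Nplus v],
    and otherwise the maximal clique [{a}]. *)
Lemma feasible_le_diag yx (v a : V) :
  feasible_point yx -> v \notin Sset -> a \in Nplus v ->
  xcoord yx.2 v a <= xcoord yx.2 v v.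
Proof.
move=> [_ xb [_ C2 _ _ _]] vS av; have vT := Nplus_notin_T av.
have [/existsP[b /andP[bv ab]]|/existsPn noe] := boolP [exists b in Nplus v, e a b].
  have := C2 v _ vT vS (Kcoll_pair av bv ab).
  have ne : a != b by apply: contraTneq ab => ->; rewrite e_irr.
  rewrite big_setU1 ?inE //= big_set1; apply: le_trans; rewrite lerDl.
  by case: (xcoord_binary v b xb) => ->.
have := C2 v [set a]%SET vT vS; rewrite big_set1; apply.
by apply: Kcoll_single => // b bv; have := noe b; rewrite bv.
Qed.

Lemma feasible_edge yx (v a b : V) :
  feasible_point yx -> a \in Nplus v -> b \in Nplus v -> e a b ->
  xcoord yx.2 v a + xcoord yx.2 v b <= 1.
Proof.
move=> [_ xb [_ C2 C3 _ _]] av bv ab; have vT := Nplus_notin_T av.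
have ne : a != b by apply: contraTneq ab => ->; rewrite e_irr.
have sumE : \sum_(c in [set a; b]%SET) xcoord yx.2 v c =
    xcoord yx.2 v a + xcoord yx.2 v b by rewrite big_setU1 ?inE //= big_set1.
rewrite -sumE; have K := Kcoll_pair av bv ab.
have [vS|vS] := boolP (v \in Sset); first exact: C3.
by apply: le_trans (C2 _ _ vT vS K) _; case: (xcoord_binary v v xb) => ->.
Qed.

(** One copy bounds the term of [v] itself in (C4) and (C5), the other the sum over [Nplus v], for
    every binary [x]. *)
Definition makespan_bound : R := (\sum_v p v)%:R + (\sum_v p v)%:R.

Lemma constraints_intro (y : R) (x : {ffun var -> R^o}) :
  is_binary x -> makespan_bound <= y ->
  (forall v, v \notin Sset -> exists2 a, a \in Nminusc e prec v & xcoord x a v = 1) ->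
  (forall v a, v \notin Sset -> a \in Nplus v -> xcoord x v a <= xcoord x v v) ->
  (forall v a b, a \in Nplus v -> b \in Nplus v -> e a b ->
    xcoord x v a + xcoord x v b <= 1) ->
  constraints p y x.
Proof.
move=> xb yM cov diag edge.
have x0 a b : 0 <= xcoord x a b by case: (xcoord_binary a b xb) => ->.
have x1 a b : xcoord x a b <= 1 by case: (xcoord_binary a b xb) => ->.
have Ksum v K : Kcoll e prec v K -> \sum_(a in K) xcoord x v a <= 1.
  move=> /andP[/fintype.subsetP KN
    /orP[/andP[clK /cards2P[a [b [ne KE]]]]|/andP[/cards1P[a ->] _]]];
    last by rewrite big_set1 x1.
  have aK : a \in K by rewrite KE !inE eqxx.
  have bK : b \in K by rewrite KE !inE eqxx orbT.
  rewrite KE big_setU1 ?inE //= big_set1; apply: edge; try exact: KN.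
  by move/forall_inP/(_ a aK)/forall_inP/(_ b bK): clK; rewrite ne.
(* The coefficient [c] is [xcoord x v v] for (C4) and 1 for (C5). *)
have load v (c : R) : c <= 1 ->
    (p v)%:R * c + \sum_(a in Nplus v) (p a)%:R * xcoord x v a <= y.
  move=> c1; apply: le_trans yM; apply: lerD.
    rewrite (bigD1 v) //= natrD -[leLHS]addr0; apply: lerD; rewrite ?ler0n //.
    by rewrite -[leRHS]mulr1 ler_wpM2l.
  rewrite natr_sum [leRHS](bigID (mem (Nplus v))) /= -[leLHS]addr0; apply: lerD.
    by apply: ler_sum => a _; rewrite -[leRHS]mulr1 ler_wpM2l.
  by apply: sumr_ge0 => a _; apply: ler0n.
split=> [v vS|v K _ vS KK|v K _ _|v vS|v vS].
- have [a aN xa] := cov v vS; rewrite (bigD1 a) //= xa lerDl.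
  exact: sumr_ge0.
(* If the diagonal entry is 0, the whole row vanishes by [diag]; if it is 1, the bound is that of
   (C3). *)
- have [v0|->] := xcoord_binary v v xb; last exact: Ksum.
  rewrite big1 ?v0 // => a aK; apply/eqP; rewrite eq_le x0 andbT -v0 diag //.
  by case/andP: KK => /fintype.subsetP/(_ a aK).
- exact: Ksum.
- exact: load.
- by rewrite -[(p v)%:R]mulr1; apply: load.
Qed.

Variable u : V.
Local Notation W := (Gplus_vertex e prec u).

(** No variable reads the default 0: for [b <> u], the pair [(u, b)] is a variable only if
    [b \in Nplus u]. *)
Definition zext (z : {ffun W -> R^o}) (b : V) : R := oapp z 0 (insub b).

Lemma zext_val z (w : W) : zext z (val w) = z w.
Proof. by rewrite /zext valK. Qed.

(* Row u carries z; elsewhere every vertex represents itself, except that the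
   vertex in s does not, and the off-diagonal entry in t is switched on. *)
Definition entry (s : option V) (t : option (V * V)) (z : {ffun W -> R^o})
    (a b : V) : R :=
  if (a == u) && (b != u) then zext z b
  else ((a == b) && (s != Some a) || (t == Some (a, b)))%:R.

Definition lift (y : R) s t z : R^o * {ffun var -> R^o} :=
  (y, [ffun k => entry s t z (val k).1 (val k).2]).

Lemma xcoord_lift y s t z (a b : V) :
  is_var e prec (a, b) -> xcoord (lift y s t z).2 a b = entry s t z a b.
Proof. by move=> ab; rewrite /xcoord insubT ffunE. Qed.

Lemma entry_u s t z (w : W) : entry s t z u (val w) = z w.
Proof.
by rewrite /entry eqxx eq_sym (Nplus_neq (valP w)) /= zext_val.
Qed.

(** The clause on [t] preserves (C2) in the row of the new entry. The clause on [s] preserves (C1),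
    by a representative taken from [t] or from row [u], and (C2) in row [u] when [u] itself is
    switched off. *)
Definition admissible (s : option V) (t : option (V * V)) (z : {ffun W -> R^o}) :
    Prop :=
  (forall a b, t = Some (a, b) -> [/\ a != u, b \in Nplus a & s != Some a]) /\
  (forall v, s = Some v -> [/\ v \notin Sset,
     (exists a, t = Some (a, v)) \/ (exists2 w : W, val w = v & z w = 1)
     & v = u -> z = 0]).

Lemma entry_diag s t z (v : V) :
  admissible s t z -> entry s t z v v = (s != Some v)%:R.
Proof.
move=> [At _]; rewrite /entry andbN eqxx /=.
have [tv|_] := eqVneq t (Some (v, v)); last by rewrite orbF.
by have [_ /Nplus_neq + _] := At _ _ tv; rewrite eqxx.
Qed.

Lemma entry_off s t z (a b : V) :
  a != u -> a != b -> entry s t z a b = (t == Some (a, b))%:R.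
Proof. by move=> /negPf au /negPf ab; rewrite /entry au ab. Qed.

Lemma lift_feasible y s t z :
  makespan_bound <= y -> stable_vector (@Gplus V e prec u) z ->
  admissible s t z -> feasible_point (lift y s t z).
Proof.
move=> yM [zb ze] Ad; have [At As] := Ad.
have zextb b : zext z b = 0 \/ zext z b = 1.
  by rewrite /zext; case: insub => [w|] /=; [apply: zb|left].
have eb a b : entry s t z a b = 0 \/ entry s t z a b = 1.
  by rewrite /entry; case: ifP => _; [apply: zextb | case: (_ || _); [right|left]].
have xb : is_binary (lift y s t z).2 by move=> k; rewrite ffunE; apply: eb.
split=> //; first by apply: le_trans yM; rewrite addr_ge0 ?ler0n.
apply: constraints_intro => // [v vS|v a vS av|v a b av bv ab].
- have [sv|sv] := eqVneq s (Some v); last first.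
    exists v; first by rewrite !inE eqxx.
    by rewrite xcoord_lift ?is_var_diag // entry_diag // sv.
  have [_ [[a ta]|[w <- zw]] _] := As v sv.
    have [au va _] := At _ _ ta.
    exists a; first by rewrite /Nminusc inE -NplusE va orbT.
    rewrite xcoord_lift ?is_var_Nplus // entry_off // ?(Nplus_neq va) //.
    by rewrite ta eqxx.
  exists u; first by rewrite /Nminusc inE -NplusE (valP w) orbT.
  by rewrite xcoord_lift ?is_var_Nplus ?(valP w) // entry_u.
- rewrite !xcoord_lift ?is_var_diag ?is_var_Nplus // entry_diag //.
  have [sv|sv] := eqVneq s (Some v); last by case: (eb v a) => ->.
  have [vu|vu] := eqVneq v u.
    have [_ _ /(_ vu) ->] := As v sv.
    rewrite vu in av *; have [w <-] : exists w : W, val w = a by exists (exist _ a av).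
    by rewrite entry_u ffunE.
  rewrite entry_off ?(Nplus_neq av) //; case: eqP => // tv.
  by have [_ _] := At _ _ tv; rewrite sv eqxx.
- rewrite !xcoord_lift ?is_var_Nplus //.
  have [vu|vu] := eqVneq v u.
    rewrite vu in av bv *.
    have := ze (exist _ a av) (exist _ b bv) ab.
    by rewrite -(entry_u s t z (exist _ a av)) -(entry_u s t z (exist _ b bv)).
  rewrite !entry_off ?(Nplus_neq av) ?(Nplus_neq bv) //.
  have ne : a != b by apply: contraTneq ab => ->; rewrite e_irr.
  case: (eqVneq t (Some (v, a))) => [->|_]; last by rewrite add0r; case: eqP.
  by rewrite (inj_eq Some_inj) xpair_eqE eqxx (negPf ne) addr0.
Qed.

(** Coordinates outside row [u] are constants, which survive because the weights sum to 1. *)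
Lemma lift_affine y s t k (c : 'I_k -> R) (z : 'I_k -> {ffun W -> R^o}) :
  \sum_i c i = 1 ->
  lift y s t (\sum_i c i *: z i) = \sum_i c i *: lift y s t (z i).
Proof.
move=> c1; apply: injective_projections.
  by rewrite linear_sum /= -scaler_suml c1 scale1r.
rewrite linear_sum; apply/ffunP => j; rewrite sum_ffunE ffunE.
under [RHS]eq_bigr do rewrite linearZ /= !ffunE.
rewrite /entry; case: ifP => _; last by rewrite -scaler_suml c1 scale1r.
rewrite /zext; case: insub => [w|] /=; last by rewrite big1 // => i _; rewrite scaler0.
by rewrite sum_ffunE; apply: eq_bigr => i _; rewrite ffunE.
Qed.

(** A point [z] of the hull is lifted through its stable vectors, so all of these must be admissible
    with [s] and [t]. *)
Lemma lift_Ppoly y s t z :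
  makespan_bound <= y -> stab R (@Gplus V e prec u) z ->
  (forall z', admissible s t z') -> Ppoly R e prec p (lift y s t z).
Proof.
move=> yM Sz Ad; apply: (conv_image _ _ Sz) => [k c a|z' sz'].
  exact: lift_affine.
exact: lift_feasible.
Qed.

End Lifting.

(** * Validity, tight points and dimension of the lifted face *)

Lemma sum_injective_support (U : nmodType) (S T : finType) (f : S -> T)
    (F : T -> U) :
  injective f -> (forall t, (forall s, t <> f s) -> F t = 0) ->
  \sum_t F t = \sum_s F (f s).
Proof.
move=> f_inj F0; rewrite [RHS](partition_big f xpredT) //.
apply: eq_bigr => t _; have [/codomP[s ->]|tf] := boolP (t \in codom f).
  by rewrite (big_pred1 s) // => s'; rewrite /= inj_eq.
rewrite big_pred0 => [|s]; last by apply: contraNF tf => /eqP <-; exact: codom_f.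
by apply: F0 => s ts; move: tf; rewrite ts codom_f.
Qed.

Section LiftedFacet.
Variables (R : realType) (V : finType) (e prec : rel V) (p : V -> nat).
Hypotheses (e_sym : symmetric e) (e_irr : irreflexive e).
Hypothesis prec_irr : irreflexive prec.
Variable u : V.

Local Notation Nplus := (Nplus e prec).
Local Notation Sset := (Sset e prec).
Local Notation var := (var e prec).
Local Notation W := (Gplus_vertex e prec u).
Local Notation E := (R^o * {ffun var -> R^o})%type.
Local Notation M := (makespan_bound R p).
Local Notation lift := (@lift R V e prec u).
Local Notation admissible := (@admissible R V e prec u).

Variables (lam : W -> R) (lam0 : R).
Hypothesis lam_ge0 : forall w : W,
  Nminus e prec (val w) = [set u]%SET -> 0 <= lam w.
Hypothesis facet_lam :
  facet_defining (stab R (@Gplus V e prec u)) (dotf lam) (fun=> lam0).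

Let h_irr : irreflexive (@Gplus V e prec u).
Proof. by move=> w; apply: e_irr. Qed.

Definition xval (a b : V) (yx : E) : R^o := xcoord yx.2 a b.
Fact xval_linear (a b : V) : linear (xval a b).
Proof. by move=> c x y; apply: xcoord_linear. Qed.
HB.instance Definition _ a b :=
  GRing.isLinear.Build R E R^o _ (xval a b) (xval_linear a b).

(** When [gamma] is a variable it moves to the left, which turns the inequality into a linear form
    bounded by a constant. *)
Definition facet_lhs (yx : E) : R^o :=
  \sum_w lam w * xval u (val w) yx
  - (if u \in Sset then 0 else lam0 * xval u u yx).
Definition facet_rhs : R := if u \in Sset then lam0 else 0.

Fact facet_lhs_linear : linear facet_lhs.
Proof.
move=> c x y; rewrite /facet_lhs scalerDr addrACA; congr (_ + _).
  rewrite scaler_sumr -big_split; apply: eq_bigr => w _.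
  by rewrite linearP /= mulrDr; congr (_ + _); rewrite mulrCA.
case: ifP => _; first by rewrite oppr0 scaler0 addr0.
by rewrite linearP /= mulrDr opprD scalerN; congr (_ + _); congr (- _); rewrite mulrCA.
Qed.
HB.instance Definition _ :=
  GRing.isLinear.Build R E R^o _ facet_lhs facet_lhs_linear.

Local Notation lhs yx := (\sum_w lam w * xcoord yx.2 u (val w)).
Local Notation rhs yx := (lam0 * gamma yx.2 u).

Lemma facet_lhs_rhs (yx : E) : lhs yx - rhs yx = facet_lhs yx - facet_rhs.
Proof.
by rewrite /facet_lhs /facet_rhs /gamma; case: ifP => _; rewrite subr0 ?mulr1.
Qed.

Lemma lifted_le (yx : E) : (lhs yx <= rhs yx) = (facet_lhs yx <= facet_rhs).
Proof. by rewrite -subr_le0 facet_lhs_rhs subr_le0. Qed.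

Lemma lifted_eq (yx : E) : (lhs yx = rhs yx) <-> (facet_lhs yx = facet_rhs).
Proof.
have lrE : (lhs yx == rhs yx) = (facet_lhs yx == facet_rhs).
  by rewrite -subr_eq0 facet_lhs_rhs subr_eq0.
by split=> /eqP eq_lr; apply/eqP; rewrite ?lrE // -lrE.
Qed.

(** On generators [gamma] is binary: if it is 1, row [u] is a stable vector of the induced subgraph;
    if it is 0, (C2) empties row [u] and both sides vanish. *)
Lemma lifted_valid yx : Ppoly R e prec p yx -> lhs yx <= rhs yx.
Proof.
rewrite lifted_le; apply: (conv_le (f := facet_lhs)) => {}yx feas.
rewrite -lifted_le; have [_ xb _] := feas : feasible_point p yx.
have row_val (w : W) : xcoord yx.2 u (val w) = 0 \/ xcoord yx.2 u (val w) = 1.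
  exact: xcoord_binary.
have [g1|g0] : gamma yx.2 u = 1 \/ (u \notin Sset /\ xcoord yx.2 u u = 0).
- rewrite /gamma; case: ifPn => [_|uS]; first by left.
  by case: (xcoord_binary u u xb) => ->; [right|left].
- pose z : {ffun W -> R^o} := [ffun w => xcoord yx.2 u (val w)].
  rewrite g1 mulr1; have -> : lhs yx = dotf lam z.
    by apply: eq_bigr => w _; rewrite ffunE.
  apply: (stab_facet_valid facet_lam); split=> [w|a b ab]; rewrite !ffunE //.
  exact: (feasible_edge e_sym e_irr feas (valP a) (valP b)).
- rewrite /gamma; case: g0 => [/[dup] uS /negPf ->] x0; rewrite x0 mulr0 big1 // => w _.
  have := feasible_le_diag e_sym e_irr feas uS (valP w); rewrite x0.
  by case: (row_val w) => ->; rewrite ?mulr0 // ler10.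
Qed.

Lemma lifted_tight y s t z :
  admissible s t z -> s != Some u ->
  lhs (lift y s t z) = rhs (lift y s t z) <-> dotf lam z = lam0.
Proof.
move=> Ad su; have -> : lhs (lift y s t z) = dotf lam z.
  apply: eq_bigr => w _; rewrite xcoord_lift ?is_var_Nplus ?(valP w) //.
  by rewrite entry_u.
suff -> : gamma (lift y s t z).2 u = 1 by rewrite mulr1.
rewrite /gamma; case: ifPn => // uS.
by rewrite xcoord_lift ?is_var_diag // entry_diag // su.
Qed.

Lemma lifted_tight0 y t :
  u \notin Sset -> admissible (Some u) t (0 : {ffun W -> R^o}) ->
  lhs (lift y (Some u) t 0) = rhs (lift y (Some u) t 0).
Proof.
move=> uS Ad; rewrite /gamma (negPf uS) xcoord_lift ?is_var_diag //.
rewrite entry_diag // eqxx mulr0 big1 // => w _.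
rewrite xcoord_lift ?is_var_Nplus ?(valP w) // entry_u // ffunE mulr0 //.
Qed.

Definition tight (yx : E) : Prop := Ppoly R e prec p yx /\ lhs yx = rhs yx.

Lemma tight_lift y s t z :
  M <= y -> (forall z', admissible s t z') -> s != Some u ->
  stab R (@Gplus V e prec u) z -> dotf lam z = lam0 -> tight (lift y s t z).
Proof.
move=> yM Ad su Sz lz; split; first exact: lift_Ppoly.
exact/lifted_tight.
Qed.

Lemma admissible_None (z : {ffun W -> R^o}) : admissible None None z.
Proof. by split. Qed.

(* One tight point per variable k. The last three conditions make the matrix
   of these points triangular up to the affinely independent block zf: they
   allow eliminating first the diagonal k, then those outside row u. *)
Definition variable_point (zf : W -> {ffun W -> R^o}) (k : var) (x : E) : Prop :=
  [/\ tight x, x.1 = M,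
    forall v, v \notin Sset -> xval v v x = (val k != (v, v))%:R,
    (val k).1 != (val k).2 -> forall a b, a != u -> b \in Nplus a ->
      xval a b x = (val k == (a, b))%:R
    & forall w : W, val k = (u, val w) -> forall w', xval u (val w') x = zf w w'].

Lemma variable_point_exists (zf : W -> {ffun W -> R^o}) (k : var) :
  (forall w, stab R (@Gplus V e prec u) (zf w) /\ dotf lam (zf w) = lam0) ->
  exists x, variable_point zf k x.
Proof.
move=> zfP; have /card_gt0P[w0 _] := stab_facet_card h_irr facet_lam.
have [Sz0 lz0] := zfP w0.
have diagE s t z v : admissible s t z -> v \notin Sset ->
    xval v v (lift M s t z) = (s != Some v)%:R.
  by move=> Ad vS; rewrite /xval xcoord_lift ?is_var_diag // entry_diag.
have offE s t z a b : a != u -> b \in Nplus a ->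
    xval a b (lift M s t z) = (t == Some (a, b))%:R.
  move=> au ba; rewrite /xval xcoord_lift ?is_var_Nplus // entry_off //.
  exact: Nplus_neq ba.
case: k => -[a b] kab; rewrite /variable_point /=.
have [ab|ab] := eqVneq a b; last first.
  have {kab} ba : b \in Nplus a.
    by move: kab; rewrite /is_var /= (negPf ab) orbF NplusE.
  have offdiag v : (a, b) != (v, v).
    by apply: contraNneq ab => -[-> ->].
  have [au|au] := eqVneq a u; last first.
    have Ad z : admissible None (Some (a, b)) z.
      by split=> // _ _ [<- <-].
    exists (lift M None (Some (a, b)) (zf w0)); split=> //.
    - exact: tight_lift.
    - by move=> v vS; rewrite diagE // offdiag.
    - by move=> _ a' b' au' ba'; rewrite offE // (inj_eq Some_inj).
    - by move=> w [au' _]; rewrite au' eqxx in au.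
  (* The variables of row [u] receive the unperturbed lifts of the facet points, one for each vertex
     of [Nplus u]. *)
  subst a; exists (lift M None None (zf (exist _ b ba))); split=> //.
  - by have [Sz lz] := zfP (exist _ b ba); apply: tight_lift.
  - by move=> v vS; rewrite diagE ?offdiag //; apply: admissible_None.
  - move=> _ a' b' au' ba'; rewrite offE // xpair_eqE [u == _]eq_sym.
    by rewrite (negPf au').
  - move=> w [bw] w'; rewrite /xval xcoord_lift ?is_var_Nplus ?(valP w') //.
    by rewrite entry_u //; congr (zf _ _); apply: val_inj.
subst b; have aS : a \notin Sset.
  move: kab; rewrite /is_var /= eqxx /= => /orP[|//].
  by rewrite -NplusE // => /(Nplus_neq prec_irr); rewrite eqxx.
have pairE v : ((a, a) != (v, v)) = (Some a != Some v).
  by rewrite xpair_eqE andbb (inj_eq Some_inj).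
have rowE (w : W) : (a, a) = (u, val w) -> False.
  by case=> -> uw; have /eqP := Nplus_neq prec_irr (valP w); apply.
(* For a diagonal [k], [s = Some a] fixes all diagonal entries and the last two conditions are
   vacuous, so [t] and [z] may be any choice giving a tight point. *)
suff [s [t [z [Ad sE Tz]]]] : exists s t z,
    [/\ admissible s t z, s = Some a & tight (lift M s t z)].
  exists (lift M s t z); split=> //.
  - by move=> v vS; rewrite diagE // sE pairE.
  - by move=> w /rowE.
have [b ba] : exists b, b \in Nminus e prec a by apply/finset.set0Pn; rewrite inE in aS.
have bP c : c \in Nminus e prec a -> a \in Nplus c /\ Some a != Some c.
  rewrite -NplusE // => ac; split=> //; rewrite (inj_eq Some_inj) eq_sym.
  exact: Nplus_neq ac.
have [au|au] := eqVneq a u.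
  have [ab nb] := bP b ba.
  have Ad : admissible (Some a) (Some (b, a)) 0.
    split=> [_ _ [<- <-]|_ [<-]]; first by rewrite -au eq_sym -(inj_eq Some_inj).
    by split=> //; left; exists b.
  exists (Some a), (Some (b, a)), 0; split=> //; subst a; split.
    by apply/conv_incl/lift_feasible => //; exact: stable_vector0.
  exact: lifted_tight0.
have sau : Some a != Some u by rewrite (inj_eq Some_inj).
(* A representative [c <> u] leaves row [u] untouched, so any facet point serves. *)
have [/existsP[c /andP[ca cu]]|noc] := boolP [exists c in Nminus e prec a, c != u].
  have [ac nc] := bP c ca.
  have Ad z : admissible (Some a) (Some (c, a)) z.
    split=> [_ _ [<- <-] //|_ [<-]]; split=> //; first by left; exists c.
    by move=> auE; rewrite auE eqxx in au.
  by exists (Some a), (Some (c, a)), (zf w0); split=> //; apply: tight_lift.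
have Na : Nminus e prec a = [set u]%SET.
  have sub c : c \in Nminus e prec a -> c = u.
    by move=> ca; move/existsPn: noc => /(_ c); rewrite ca negbK => /eqP.
  by apply/finset.setP => c; rewrite [RHS]inE; apply/idP/eqP => [/sub //|->];
    rewrite -(sub b ba).
have uNa : a \in Nplus u by rewrite NplusE // Na inE.
pose w : W := exist _ a uNa.
(* Admissibility now depends on [z w = 1], so a single stable vector is lifted instead of a point of
   the hull. *)
have [z [sz lz zw]] := stab_facet_touches h_irr facet_lam (lam_ge0 (w := w) Na).
have Ad : admissible (Some a) None z.
  split=> // _ [<-]; split=> //; first by right; exists w.
  by move=> auE; rewrite auE eqxx in au.
exists (Some a), None, z; split=> //; split; last exact/lifted_tight.
exact/conv_incl/lift_feasible.
Qed.

(** The extra point, at height [M + 1], is isolated by the coordinate [y]; the points of the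
    variables are then eliminated in triangular order. *)
Lemma tight_family :
  exists q : option var -> E, (forall o, tight (q o)) /\ aff_indep q.
Proof.
have [zf [zfP zfI]] := stab_facet_family h_irr facet_lam.
have /card_gt0P[w0 _] := stab_facet_card h_irr facet_lam.
have [q qP] := choice (fun k => variable_point_exists k zfP).
exists (fun o => oapp q (lift (M + 1) None None (zf w0)) o); split=> [[k|]|] /=.
- by case: (qP k).
- have [Sz lz] := zfP w0; by apply: tight_lift => //; rewrite lerDl ler01.
move=> c; rewrite !sum_option /= => c0 cq0.
have cN : c None = 0.
  have := congr1 fst cq0; rewrite linearD linear_sum /=.
  have -> : \sum_k (c (Some k) *: q k).1 = \sum_k c (Some k) * M.
    by apply: eq_bigr => k _; have [_ /= <-] := qP k.
  rewrite -mulr_suml => yE; rewrite -[LHS]mulr1; apply/eqP.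
  move: yE; rewrite -[_ *: _]/(_ * _) mulrDr addrAC -mulrDl c0 mul0r add0r.
  by move=> ->.
rewrite cN scale0r !add0r in c0 cq0.
pose d k := c (Some k).
have coordE a b : \sum_k d k * xval a b (q k) = 0.
  have := congr1 (xval a b) cq0; rewrite linear0 linear_sum => sum0.
  by rewrite -[RHS]sum0; apply: eq_bigr => k _; rewrite linearZ.
(* The coordinate of a diagonal [k] is 0 at [q k] and 1 at every other [q j], so the coefficients
   other than [d k] sum to 0, as do all of them together. *)
have d_diag (k : var) : (val k).1 = (val k).2 -> d k = 0.
  move=> kd; have kE : val k = ((val k).1, (val k).1).
    by rewrite {2}kd -surjective_pairing.
  have kS : (val k).1 \notin Sset.
    move: (valP k); rewrite /is_var -kd eqxx /= => /orP[|//].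
    by rewrite -NplusE // => /(Nplus_neq prec_irr); rewrite eqxx.
  have := coordE (val k).1 (val k).1; rewrite (bigD1 k) //=.
  have [_ _ -> // _ _] := qP k; rewrite -kE eqxx mulr0 add0r => rest0.
  move: c0; rewrite (bigD1 k) //= => c0; rewrite -[RHS]c0 -[LHS]addr0.
  congr (_ + _); rewrite -[LHS]rest0; apply: eq_bigr => j jk.
  have [_ _ -> // _ _] := qP j.
  by rewrite -kE (inj_eq val_inj) jk mulr1.
(* Diagonal points may also have this coordinate switched on, but their coefficients are already 0;
   among the others only [q k] has it. *)
have d_off (k : var) : (val k).1 != u -> d k = 0.
  move=> ku; have [/d_diag //|kd] := eqVneq (val k).1 (val k).2.
  have kN : (val k).2 \in Nplus (val k).1.
    by move: (valP k); rewrite /is_var (negPf kd) /= orbF NplusE.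
  have := coordE (val k).1 (val k).2; rewrite (bigD1 k) //= big1 => [|j jk].
    have [_ _ _ -> // _] := qP k.
    by rewrite -surjective_pairing eqxx mulr1 addr0.
  have [/d_diag ->|jd] := eqVneq (val j).1 (val j).2; first by rewrite mul0r.
  have [_ _ _ -> // _] := qP j.
  by rewrite -surjective_pairing (inj_eq val_inj) (negPf jk) mulr0.
pose row (w : W) : var := exist _ (u, val w) (is_var_Nplus e_sym (valP w)).
have row_inj : injective row.
  by move=> w w' /(congr1 val) /= -[/val_inj].
have d_row k : (forall w, k <> row w) -> d k = 0.
  move=> krow; have [ku|] := eqVneq (val k).1 u; last exact: d_off.
  have [/d_diag //|kd] := eqVneq (val k).1 (val k).2.
  have kN : (val k).2 \in Nplus u.
    by rewrite -ku; move: (valP k); rewrite /is_var (negPf kd) /= orbF NplusE.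
  case: (krow (Sub (val k).2 kN)); apply: val_inj.
  by rewrite /= -ku -surjective_pairing.
(* Only row [u] is left, where the points restrict to the affinely independent family [zf]. *)
have dr w : d (row w) = 0.
  apply: (zfI (d \o row)).
    by rewrite -[RHS]c0 [RHS](sum_injective_support row_inj d_row).
  apply/ffunP => w'; rewrite sum_ffunE [RHS]ffunE -[RHS](coordE u (val w')).
  rewrite [RHS](sum_injective_support row_inj) => [|k /d_row ->]; last by rewrite mul0r.
  by apply: eq_bigr => w1 _; have [_ _ _ _ rE] := qP (row w1);
    rewrite !ffunE (rE w1).
case=> // k; have [/codomP[w ->]|krow] := boolP (k \in codom row); first exact: dr.
by apply: d_row => w kw; rewrite kw codom_f in krow.
Qed.

(** The point [x1] off the hyperplane extends any affinely independent tight family. Added to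
    [tight_family] it makes the polytope full-dimensional, and it bounds every such family by
    [#|var| + 1] points. *)
Lemma lifted_facet :
  facet_defining (Ppoly R e prec p) (fun yx => lhs yx) (fun yx => rhs yx).
Proof.
split; first exact: lifted_valid.
have [q [qT qI]] := tight_family.
have [z1 Sz1 lz1] := stab_facet_proper facet_lam.
pose x1 := lift M None None z1.
have Px1 : Ppoly R e prec p x1 by apply: lift_Ppoly => //; apply: admissible_None.
have x1F : facet_lhs x1 <> facet_rhs.
  by move/lifted_eq/lifted_tight => /(_ (admissible_None _) isT).
have extend (T : finType) (q' : T -> E) : (forall t, tight (q' t)) ->
    aff_indep q' -> aff_indep (fun o => oapp q' x1 o).
  move=> q'T q'I; apply: (aff_indep_extend (f := facet_lhs) q'I) x1F => t.
  by apply/lifted_eq; case: (q'T t).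
have dimE : dim E = #|var|.+1 by rewrite [dim _]/(1 + #|var| * 1)%N muln1.
exists #|var|; split.
  apply: (has_dim_intro _ (extend _ _ qT qI)) => [|[o|] //=|q' _ q'I].
  - by rewrite !card_option.
  - by case: (qT o).
  - by have := aff_indep_card (q'I : aff_indep q'); rewrite card_ord dimE ltnn.
apply: (has_dim_intro (card_option _) qI qT) => q' q'T q'I.
have := aff_indep_card (extend _ _ q'T q'I).
by rewrite card_option card_ord dimE ltnn.
Qed.

End LiftedFacet.

(** Nonnegativity is asked where only [u] can represent [w] besides [w] itself. There, lifting
    [- z_w <= 0] would give the face [x_uw = 0], on which (C1) forces [x_ww = 1], so a second
    dimension is lost. *)
Theorem theorem4 (R : realType) (V : finType) (e : rel V)
    (e_sym : symmetric e) (e_irr : irreflexive e)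
    (p : V -> nat) (p_gt0 : forall v, (0 < p v)%N)
    (prec : rel V) (prec_total : strict_total_order prec) (u : V)
    (lambda : Gplus_vertex e prec u -> R) (lambda0 : R)
    (lambda_ge0 : forall w : Gplus_vertex e prec u,
      Nminus e prec (val w) = [set u]%SET -> 0 <= lambda w) :
  facet_defining (stab R (@Gplus V e prec u))
    (fun z => \sum_w lambda w * z w)
    (fun=> lambda0) ->
  facet_defining (Ppoly R e prec p)
    (fun yx => \sum_w lambda w * xcoord yx.2 u (val w))
    (fun yx => lambda0 * gamma yx.2 u).
Proof.
move=> facet_lam; case: prec_total => prec_irr _ _.
exact: lifted_facet.
Qed.
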